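(* For every positive integer $k$, \[ \sum_{b\ge0} J(b,k,1)x^b = \sum_{\alpha\in \mathrm{Comp}(k)} \frac{(-1)^{\ell_2(\alpha)}\, x^{k-\ell(\alpha)}}{(1-x-\cdots-x^{k})^{1+\ell(\alpha)}}. \]
   Context: A composition is a finite sequence $\alpha=(\alpha_1,\dots,\alpha_r)$ of positive integers; its size is $|\alpha|=\alpha_1+\dots+\alpha_r$, its length is $\ell(\alpha)=r$, and $\ell_2(\alpha)$ is the number of parts of $\alpha$ that are at least $2$. $\mathrm{Comp}(k)$ is the set of compositions of size $k$. Write $[n]=\{1,\dots,n\}$. A (multiplex juggling) card is a triple $(\alpha,\beta,f)$ where $\alpha=(\alpha_1,\dots,\alpha_s)$ and $\beta=(\beta_1,\dots,\beta_t)$ are compositions (possibly empty) with $|\alpha|=|\beta|$, and $f:[s]\to\{0\}\cup[t]$ is strictly increasing such that for all $i\in[s]$, if $f(i)\neq0$ then $\alpha_i\le\beta_{f(i)}$. The card has $|\alpha|$ balls and has capacity $k$ if every part of $\alpha$ and $\beta$ is at most $k$. $J(b,k,1)$ is the number of cards with $b$ balls and capacity $k$. *)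

(* Defs.v *)
From HB Require Import structures.
From mathcomp Require Import all_boot all_order all_algebra.
From mathcomp Require Import boolp.
Set Implicit Arguments.
Unset Strict Implicit.
Unset Printing Implicit Defensive.
Import GRing.Theory.
Local Open Scope ring_scope.

(** MathComp has no univariate formal power series; this is the ring R[[x]],
    with the Cauchy product.  It is a record so that the pointwise product of
    functions does not interfere. *)

Record fps (R : Type) := Fps { fps_coef : nat -> R }.

HB.instance Definition _ (R : Type) := gen_eqMixin (fps R).
HB.instance Definition _ (R : Type) := gen_choiceMixin (fps R).

Lemma fpsP (R : Type) (u v : fps R) : fps_coef u =1 fps_coef v -> u = v.
Proof. by case: u v => [u] [v] /= /funext ->. Qed.

Section Zmod.
Variable R : zmodType.
Implicit Types u v : fps R.

Definition fps_zero : fps R := Fps (fun=> 0).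
Definition fps_opp u : fps R := Fps (fun n => - fps_coef u n).
Definition fps_add u v : fps R := Fps (fun n => fps_coef u n + fps_coef v n).

Fact fps_addA : associative fps_add.
Proof. by move=> u v w; apply: fpsP => n /=; rewrite addrA. Qed.
Fact fps_addC : commutative fps_add.
Proof. by move=> u v; apply: fpsP => n /=; rewrite addrC. Qed.
Fact fps_add0 : left_id fps_zero fps_add.
Proof. by move=> u; apply: fpsP => n /=; rewrite add0r. Qed.
Fact fps_addN : left_inverse fps_zero fps_opp fps_add.
Proof. by move=> u; apply: fpsP => n /=; rewrite addNr. Qed.

HB.instance Definition _ :=
  GRing.isZmodule.Build (fps R) fps_addA fps_addC fps_add0 fps_addN.

Lemma fps_coef0 n : fps_coef (0 : fps R) n = 0. Proof. by []. Qed.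
Lemma fps_coefD u v n : fps_coef (u + v) n = fps_coef u n + fps_coef v n.
Proof. by []. Qed.
Lemma fps_coefN u n : fps_coef (- u) n = - fps_coef u n. Proof. by []. Qed.
Lemma fps_coefB u v n : fps_coef (u - v) n = fps_coef u n - fps_coef v n.
Proof. by []. Qed.
Lemma fps_coef_sum (I : Type) (r : seq I) (P : pred I) (F : I -> fps R) n :
  fps_coef (\sum_(i <- r | P i) F i) n = \sum_(i <- r | P i) fps_coef (F i) n.
Proof. by elim/big_rec2: _ => // i x y _ <-. Qed.

End Zmod.

Section Ring.
Variable R : comNzRingType.
Implicit Types u v w : fps R.

Definition fps_const (c : R) : fps R := Fps (fun n => if n == 0%N then c else 0).
Definition fps_X : fps R := Fps (fun n => (n == 1%N)%:R).
Definition fps_mul u v : fps R :=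
  Fps (fun n => \sum_(i < n.+1) fps_coef u i * fps_coef v (n - i)).

Definition fps_trunc (N : nat) u : {poly R} := \poly_(i < N) fps_coef u i.

Lemma fps_coef_trunc N u n : (n < N)%N -> fps_coef u n = (fps_trunc N u)`_n.
Proof. by move=> lt_nN; rewrite coef_poly lt_nN. Qed.

Lemma fps_coef_mul_trunc N u v n : (n < N)%N ->
  fps_coef (fps_mul u v) n = (fps_trunc N u * fps_trunc N v)`_n.
Proof.
move=> ltnN; rewrite coefM; apply: eq_bigr => i _.
rewrite -!fps_coef_trunc //; first exact: leq_ltn_trans (leq_subr _ _) ltnN.
by apply: leq_trans ltnN; apply: ltn_ord.
Qed.

Fact fps_mulC : commutative fps_mul.
Proof.
by move=> u v; apply: fpsP => n; rewrite !(@fps_coef_mul_trunc n.+1) // mulrC.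
Qed.

Fact fps_mulA : associative fps_mul.
Proof.
move=> u v w; apply: fpsP => n.
transitivity ((fps_trunc n.+1 u * (fps_trunc n.+1 v * fps_trunc n.+1 w))`_n).
  rewrite coefM; apply: eq_bigr => i _.
  by rewrite -fps_coef_trunc // -fps_coef_mul_trunc // ltnS leq_subr.
rewrite mulrA coefM; apply: eq_bigr => i _.
by rewrite -fps_coef_mul_trunc // -fps_coef_trunc // ltnS leq_subr.
Qed.

Fact fps_mul1 : left_id (fps_const 1) fps_mul.
Proof.
move=> u; apply: fpsP => n /=; rewrite big_ord_recl /= mul1r subn0.
by rewrite big1 ?addr0 // => i _; rewrite mul0r.
Qed.

Fact fps_mulDl : left_distributive fps_mul +%R.
Proof.
move=> u v w; apply: fpsP => n /=; rewrite -big_split /=.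
by apply: eq_bigr => i _; rewrite mulrDl.
Qed.

Fact fps_1neq0 : fps_const 1 != 0.
Proof.
apply/eqP => /(congr1 (fun u => fps_coef u 0)) /= /eqP.
by rewrite oner_eq0.
Qed.

HB.instance Definition _ := GRing.Zmodule_isComNzRing.Build (fps R)
  fps_mulA fps_mulC fps_mul1 fps_mulDl fps_1neq0.

Lemma fps_coef1 n : fps_coef (1 : fps R) n = (n == 0%N)%:R.
Proof. by rewrite /=; case: eqP. Qed.
Lemma fps_coefM u v n :
  fps_coef (u * v) n = \sum_(i < n.+1) fps_coef u i * fps_coef v (n - i).
Proof. by []. Qed.
Lemma fps_coefCM c u n : fps_coef (fps_const c * u) n = c * fps_coef u n.
Proof.
rewrite fps_coefM big_ord_recl /= subn0 big1 ?addr0 // => i _.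
by rewrite mul0r.
Qed.

Lemma fps_coefX_lt w n j : fps_coef w 0 = 0 -> (n < j)%N ->
  fps_coef (w ^+ j) n = 0.
Proof.
move=> w0; elim: j n => // j IHj n ltnj.
rewrite exprS fps_coefM big_ord_recl /= w0 mul0r add0r big1 // => i _.
rewrite IHj ?mulr0 //; rewrite /bump /= add1n.
by case: n ltnj i => [|n] ltnj i; [case: i | rewrite subSS (leq_ltn_trans (leq_subr _ _))].
Qed.

End Ring.

Section Inverse.
Variable R : comUnitRingType.
Implicit Types u v : fps R.

Definition fps_unit : pred (fps R) := fun u => fps_coef u 0 \is a GRing.unit.

(* 1/u = sum_j c^-1 (1 - c^-1 u)^j with c = u(0); the j-th term has no
   coefficient below degree j. *)
Definition fps_inv u : fps R :=
  if fps_unit u then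
    let c' := fps_const (fps_coef u 0)^-1 in
    Fps (fun n => fps_coef (\sum_(j < n.+1) c' * (1 - c' * u) ^+ j) n)
  else u.

Fact fps_mulV : {in fps_unit, left_inverse 1 fps_inv *%R}.
Proof.
move=> u; rewrite unfold_in => uU.
rewrite /fps_inv /fps_unit uU; set c' := fps_const _; set v := Fps _.
set w := 1 - c' * u.
have w0 : fps_coef w 0 = 0.
  by rewrite fps_coefB fps_coefCM fps_coef1 mulVr // subrr.
apply: fpsP => n; rewrite mulrC.
transitivity (fps_coef (u * \sum_(j < n.+1) c' * w ^+ j) n).
  rewrite !fps_coefM; apply: eq_bigr => i _; congr (_ * _).
  rewrite /v /= !fps_coef_sum.
  rewrite (big_ord_widen n.+1 (fun j => fps_coef (c' * w ^+ j) (n - i))).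
    rewrite big_mkcond; apply: eq_bigr => j _; case: ifPn => //.
    by rewrite -leqNgt => ltj; rewrite fps_coefCM fps_coefX_lt ?mulr0.
  by rewrite ltnS leq_subr.
rewrite -mulr_sumr mulrA [u * c']mulrC.
have -> : c' * u = 1 - w by rewrite /w opprB addrC subrK.
by rewrite -opprB mulNr -subrX1 opprB fps_coefB fps_coefX_lt ?subr0.
Qed.

Fact fps_unitPl u v : v * u = 1 -> fps_unit u.
Proof.
move=> /(congr1 (fun u => fps_coef u 0)).
rewrite fps_coefM big_ord1 fps_coef1 /= => vu1.
by apply/unitrPr; exists (fps_coef v 0); rewrite mulrC.
Qed.

Fact fps_inv_out : {in [predC fps_unit], fps_inv =1 id}.
Proof. by move=> u; rewrite inE unfold_in /fps_inv /fps_unit => /negbTE ->. Qed.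

HB.instance Definition _ := GRing.ComNzRing_hasMulInverse.Build (fps R)
  fps_mulV fps_unitPl fps_inv_out.

Lemma fps_unitE u : (u \is a GRing.unit) = (fps_coef u 0 \is a GRing.unit).
Proof. by []. Qed.

End Inverse.

Definition is_composition (n : nat) (s : seq nat) : bool :=
  all (leq 1) s && (sumn s == n).

Record composition (n : nat) := Composition { parts :> seq nat; _ : is_composition n parts }.

HB.instance Definition _ (n : nat) := [isSub for @parts n].
HB.instance Definition _ (n : nat) := [Countable of composition n by <:].

Lemma comp_sumn n (a : composition n) : sumn a = n.
Proof. by case: a => s /= /andP[_ /eqP]. Qed.

Lemma comp_gt0 n (a : composition n) : all (leq 1) a.
Proof. by case: a => s /= /andP[]. Qed.

Lemma comp_size n (a : composition n) : (size a <= n)%N.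
Proof.
rewrite -[leqRHS](comp_sumn a); elim: (parts a) (comp_gt0 a) => //= m s IHs.
by case/andP=> m_gt0 /IHs; rewrite -add1n; apply: leq_add.
Qed.

Lemma comp_part_le n (a : composition n) m : m \in parts a -> (m <= n)%N.
Proof.
rewrite -[X in (_ <= X)%N](comp_sumn a); elim: (parts a) => //= p s IHs.
rewrite inE => /orP[/eqP -> | /IHs le_ms]; first exact: leq_addr.
exact: leq_trans le_ms (leq_addl _ _).
Qed.

Fact comp_code_subproof n (a : composition n) :
  (size [seq inord i : 'I_n.+1 | i <- parts a] <= n)%N.
Proof. by rewrite size_map comp_size. Qed.

Definition comp_code n (a : composition n) : {bseq n of 'I_n.+1} :=
  Bseq (comp_code_subproof a).
Definition comp_decode n (t : {bseq n of 'I_n.+1}) : option (composition n) :=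
  insub (map val t).

Fact comp_codeK n : pcancel (@comp_code n) (@comp_decode n).
Proof.
move=> a; rewrite /comp_decode /= -map_comp.
rewrite map_id_in => [|m /comp_part_le le_mn /=]; last by rewrite inordK.
exact: valK.
Qed.

HB.instance Definition _ (n : nat) : isFinite (composition n) :=
  PCanIsFinite (@comp_codeK n).

Definition ell2 (s : seq nat) : nat := count (leq 2) s.

(** Candidate triples (alpha, beta, f) with |alpha| = |beta| = b.  Parts are
    indexed from 0, but the values of f keep their meaning: 0 is the extra
    point and j > 0 is the j-th part of beta, i.e. its entry of index j.-1. *)
Definition precard (b : nat) : Type :=
  {ab : composition b * composition b & {ffun 'I_(size ab.1) -> 'I_(size ab.2).+1}}.

HB.instance Definition _ (b : nat) := Finite.on (precard b).

Definition card_top b (c : precard b) : composition b := (tag c).1.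
Definition card_bot b (c : precard b) : composition b := (tag c).2.
Definition card_fun b (c : precard b) :
  {ffun 'I_(size (card_top c)) -> 'I_(size (card_bot c)).+1} := tagged c.

Definition is_card b (c : precard b) : bool :=
  [forall i : 'I_(size (card_top c)), forall j : 'I_(size (card_top c)),
     (i < j)%N ==> (card_fun c i < card_fun c j)%N] &&
  [forall i : 'I_(size (card_top c)), (card_fun c i != 0%N :> nat) ==>
     (nth 0 (card_top c) i <= nth 0 (card_bot c) (card_fun c i).-1)%N].

Definition has_capacity b (k : nat) (c : precard b) : bool :=
  all (geq k) (card_top c) && all (geq k) (card_bot c).

(** The number J(b, k, 1). *)
Definition J (b k : nat) : nat :=
  #|[set c : precard b | is_card c && has_capacity k c]|.

(* Main.v *)
(* Write m_j for the j-th part of beta, a_j for the part of alpha sent to it (0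
   if there is none) and a_0 for the part sent to 0. Since f is strictly
   increasing, a card with b balls and capacity k is the same as a word of
   letters (m_j, d_j), d_j = m_j - a_j, with 1 <= m_j <= k, 0 <= d_j <= m_j and
   sum m_j = b; as |alpha| = |beta|, the part a_0 is sum d_j, and the capacity
   only requires this to be at most k.
   Let G_n be the generating function of the words with sum d_j <= n and
   P = 1 - x - ... - x^k. Splitting off the first letter gives
     G_n = 1 + sum_m x^m (G_n + G_(n-1) + ... + G_(n-m)), G_i = 0 for i < 0,
   whence, subtracting consecutive equations, P G_0 = 1 and
     P G_(n+1) = G_n - sum_(1 <= m <= n) x^m G_(n-m)   for n < k.
   Splitting off the first part m + 1 of a composition of n + 1 shows that the
   sum on the right-hand side of the theorem, with Comp(k) replaced by Comp(n)
   but P kept, obeys the same recursion. *)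

Require Import Defs.
From HB Require Import structures.
From mathcomp Require Import all_boot all_order all_algebra zify ring.
Set Implicit Arguments.
Unset Strict Implicit.
Unset Printing Implicit Defensive.
Import GRing.Theory.

(** * Nonzero entries of a sequence and their positions *)

Definition supp (A : seq nat) := [seq j <- iota 0 (size A) | 0 < nth 0 A j].
Definition vals (A : seq nat) := [seq nth 0 A j | j <- supp A].

(* Positions outside [F] get the default value [0], since there [index]
   returns [size F]. *)
Definition spread n (v F : seq nat) := mkseq (fun j => nth 0 v (index j F)) n.

Lemma mem_supp A j : (j \in supp A) = (0 < nth 0 A j).
Proof.
rewrite mem_filter mem_iota /= add0n.
by case: (ltnP j) => [|lej]; rewrite ?andbT // nth_default.
Qed.

Lemma sorted_supp A : sorted ltn (supp A).
Proof. exact/sorted_filter/iota_ltn_sorted/ltn_trans. Qed.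

Lemma size_vals A : size (vals A) = size (supp A).
Proof. exact: size_map. Qed.

Lemma sumn_vals A : sumn (vals A) = sumn A.
Proof.
rewrite !sumnE big_map big_filter big_mkcond [RHS](big_nth 0) /index_iota subn0.
by apply: eq_bigr => j _; case: ltnP => //; rewrite leqn0 => /eqP.
Qed.

Lemma vals_gt0 A : all (leq 1) (vals A).
Proof. by apply/allP => _ /mapP[j + ->]; rewrite mem_supp. Qed.

(** Together with [supp_spread] and [vals_spread], this is the dictionary between the pair (alpha,
    f) and the sequence a_0, a_1, ...: alpha is read off by [vals], f by [supp]. *)
Lemma spreadK A : spread (size A) (vals A) (supp A) = A.
Proof.
apply: (@eq_from_nth _ 0); rewrite size_mkseq // => j ltj.
rewrite nth_mkseq //; have [jS|jS] := boolP (j \in supp A).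
  by rewrite (nth_map 0) ?index_mem ?nth_index.
rewrite nth_default ?size_vals; last by rewrite leqNgt index_mem.
by move: jS; rewrite mem_supp -leqNgt leqn0 => /eqP.
Qed.

Section Spread.
Variables (n : nat) (v F : seq nat).
Hypotheses (sF : sorted ltn F) (ltF : all (gtn n) F).
Hypotheses (szv : size v = size F) (v0 : all (leq 1) v).

(** Since the entries of [v] are positive, the nonzero positions are exactly those in [F], and
    strictly increasing lists with the same members are equal. *)
Lemma supp_spread : supp (spread n v F) = F.
Proof.
apply: (irr_sorted_eq ltn_trans ltnn) => //; first exact: sorted_supp.
move=> j; rewrite mem_supp; have [ltj|lenj] := ltnP j n; last first.
  rewrite nth_default ?size_mkseq // ltnn; apply/esym/negbTE/negP.
  by move=> /(allP ltF) /=; lia.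
rewrite nth_mkseq // -index_mem -szv; have [lti|?] := ltnP (index j F).
  by have := allP v0 _ (mem_nth 0 lti).
by rewrite nth_default.
Qed.

Lemma vals_spread : vals (spread n v F) = v.
Proof.
apply: (@eq_from_nth _ 0); rewrite size_vals supp_spread // => i lti.
rewrite (nth_map 0) supp_spread // nth_mkseq; last exact: (all_nthP 0 ltF).
by rewrite index_uniq // (sorted_uniq ltn_trans ltnn).
Qed.

End Spread.

(** * Words and their enumeration *)

Definition letters k : seq (nat * nat) :=
  [seq (m, d) | m <- iota 1 k, d <- iota 0 m.+1].

Lemma mem_letters k l : (l \in letters k) = (0 < l.1 <= k) && (l.2 <= l.1).
Proof.
case: l => m d /=; apply/allpairsPdep/idP => [[m' [d' []]]|H].
  by rewrite !mem_iota => ? ? [-> ->]; lia.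
by exists m, d; split; rewrite ?mem_iota //; lia.
Qed.

Lemma letters_uniq k : uniq (letters k).
Proof.
apply: allpairs_uniq_dep => [|m _|]; rewrite ?iota_uniq //.
by move=> [m d] [m' d'] _ _ /= [-> ->].
Qed.

Definition is_word k b n (w : seq (nat * nat)) :=
  [&& all (mem (letters k)) w, sumn (unzip1 w) == b & sumn (unzip2 w) <= n].

(** [f] is fuel, as the call on [b - l.1] is not structural; every letter has [l.1 >= 1], so fuel
    [b] suffices. *)
Fixpoint words k f b n : seq (seq (nat * nat)) :=
  if f is f'.+1 then
    if b == 0 then [:: [::]] else
    [seq l :: w | l <- [seq l <- letters k | (l.1 <= b) && (l.2 <= n)],
                  w <- words k f' (b - l.1) (n - l.2)]
  else if b == 0 then [:: [::]] else [::].

Lemma words0 k f n : words k f 0 n = [:: [::]].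
Proof. by case: f. Qed.

Lemma wordsS k f b n : words k f.+1 b.+1 n =
  [seq l :: w | l <- [seq l <- letters k | (l.1 <= b.+1) && (l.2 <= n)],
                w <- words k f (b.+1 - l.1) (n - l.2)].
Proof. by []. Qed.

Lemma words_fuel k f b n : b <= f -> words k f b n = words k b b n.
Proof.
elim/ltn_ind: b f n => -[|b] IHb [|f] n //.
rewrite ltnS => lebf; rewrite !wordsS.
congr flatten; apply/eq_in_map => -[m d]; rewrite mem_filter mem_letters /= => ?.
by rewrite IHb ?[in RHS]IHb //; lia.
Qed.

Lemma is_word_cons k b n l w : is_word k b n (l :: w) =
  [&& l \in letters k, l.1 <= b, l.2 <= n & is_word k (b - l.1) (n - l.2) w].
Proof.
rewrite /is_word /=; case: (l \in letters k) => //=.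
case: (all _ w) => /=; last by rewrite !andbF.
by apply/idP/idP; lia.
Qed.

Lemma mem_words k b n w : (w \in words k b b n) = is_word k b n w.
Proof.
elim: w b n => [|[m d] w IHw] [|b] n.
- by rewrite words0.
- by apply/negbTE/negP => /allpairsPdep[? [? []]].
- rewrite words0 inE is_word_cons mem_letters /=; apply/esym/negbTE/negP; lia.
rewrite is_word_cons wordsS.
apply/allpairsPdep/and4P => [[[m' d'] [w' []]]|/= [lL leb len wW]].
  rewrite mem_filter /= => /andP[/andP[leb len] lL] wW [-> -> Ew].
  split=> //; rewrite -IHw Ew -(@words_fuel k b) //.
  by move: lL; rewrite mem_letters /=; lia.
exists (m, d), w; rewrite mem_filter /= leb len words_fuel ?IHw //.
by move: lL; rewrite mem_letters /=; lia.
Qed.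

Lemma words_uniq k f b n : uniq (words k f b n).
Proof.
elim: f b n => [|f IHf] [|b] n //; rewrite wordsS.
apply: allpairs_uniq_dep => [|//|[l w] [l' w'] _ _ /= [-> ->] //].
exact/filter_uniq/letters_uniq.
Qed.

(** Splitting off the first letter; the term [b == 0] counts the empty word, and the guards keep
    both subtractions exact. *)
Lemma size_words k b n : size (words k b b n) =
  (b == 0) + \sum_(l <- letters k | (l.1 <= b) && (l.2 <= n))
                size (words k (b - l.1) (b - l.1) (n - l.2)).
Proof.
case: b => [|b].
  rewrite words0 big_seq_cond big_pred0 // => -[m d].
  by rewrite mem_letters /=; apply/negbTE/negP; lia.
rewrite wordsS size_allpairs_dep sumnE big_map big_filter add0n.
rewrite big_seq_cond [RHS]big_seq_cond; apply: eq_bigr => -[m d].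
by rewrite mem_letters /= => ?; rewrite words_fuel //; lia.
Qed.

(** * Cards as triples of lists, and their bijection with words *)

Definition triple : Type := seq nat * seq nat * seq nat.

(** The card and capacity conditions freed from the dependent type of f: [F] lists its values, with
    0 still the extra point, whence [(size beta).+1] and [.-1]. *)
Definition valid b k (t : triple) :=
  let: (v, beta, F) := t in
  [/\ is_composition b v && is_composition b beta,
      all (geq k) v && all (geq k) beta,
      size v = size F, sorted ltn F && all (gtn (size beta).+1) F &
      forall i, i < size v -> nth 0 F i != 0 ->
        nth 0 v i <= nth 0 beta (nth 0 F i).-1].

Definition triple_of b (c : precard b) : triple :=
  (parts (card_top c), parts (card_bot c),
   [seq val (card_fun c i) | i <- enum 'I_(size (card_top c))]).

Lemma triple_of_inj b : injective (@triple_of b).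
Proof.
move=> [[v w] f] [[v' w'] f']; rewrite /triple_of /card_top /card_bot /card_fun /=.
case=> /val_inj Ev /val_inj Ew; subst v' w' => /eq_in_map Ef.
congr existT; apply/ffunP => i; apply: val_inj.
by apply: Ef; rewrite mem_enum.
Qed.

Lemma triple_of_nth b (c : precard b) (i : 'I_(size (card_top c))) :
  nth 0 (triple_of c).2 i = card_fun c i.
Proof. by rewrite (nth_map i) ?size_enum_ord // nth_ord_enum. Qed.

Lemma validP b k (t : triple) :
  reflect (valid b k t)
    (t \in [seq triple_of c |
              c <- enum [set c : precard b | is_card c && has_capacity k c]]).
Proof.
apply: (iffP mapP) => [[c]|].
  rewrite mem_enum inE => /andP[/andP[/forallP inc /forallP le] cap] ->.
  split=> //.
  - by rewrite /is_composition !comp_sumn !eqxx !comp_gt0.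
  - by rewrite size_map size_enum_ord.
  - apply/andP; split.
      apply/(sortedP 0) => i; rewrite size_map size_enum_ord => lti.
      have := inc (Ordinal (ltnW lti)) => /forallP/(_ (Ordinal lti)) /=.
      by rewrite ltnSn -!triple_of_nth.
    by apply/allP => _ /mapP[i _ ->] /=; rewrite ltn_ord.
  - move=> i lti; have := le (Ordinal lti).
    by rewrite -triple_of_nth => /implyP.
case: t => [[v w] F] [/andP[cv cw] cap szF /andP[sF bF] le].
pose f : {ffun 'I_(size v) -> 'I_(size w).+1} := [ffun i => inord (nth 0 F (val i))].
have fE (i : 'I_(size v)) : f i = nth 0 F i :> nat.
  by rewrite ffunE inordK //; apply: (all_nthP 0 bF); rewrite -szF ltn_ord.
pose c : precard b := existT _ (Composition cv, Composition cw) f.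
exists c; last first.
  congr (_, _, _); apply: (@eq_from_nth _ 0).
    by rewrite size_map size_enum_ord.
  rewrite -szF => i lti.
  by rewrite (triple_of_nth (Ordinal lti : 'I_(size (card_top c)))) fE.
rewrite mem_enum inE; apply/andP; split=> //; apply/andP; split.
  apply/forallP => i; apply/forallP => j; apply/implyP => ltij.
  rewrite !fE; apply: (sorted_ltn_nth ltn_trans) => //; by rewrite inE -szF.
by apply/forallP => i; apply/implyP; rewrite !fE; apply: le.
Qed.

(* The sequence a_0, a_1, a_2, ... of the header. *)
Definition profile (w : seq (nat * nat)) :=
  sumn (unzip2 w) :: [seq l.1 - l.2 | l <- w].

Definition word_triple (w : seq (nat * nat)) : triple :=
  (vals (profile w), unzip1 w, supp (profile w)).

(** [behead] drops a_0, which |alpha| = |beta| determines from the other entries. *)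
Definition triple_word (t : triple) : seq (nat * nat) :=
  let: (v, beta, F) := t in
  let A := spread (size beta).+1 v F in
  [seq (p.1, p.1 - p.2) | p <- zip beta (behead A)].

Lemma word_tripleK k b n w : is_word k b n w -> triple_word (word_triple w) = w.
Proof.
case/and3P=> /allP wL _ _.
rewrite /triple_word /word_triple.
have -> : (size (unzip1 w)).+1 = size (profile w) by rewrite /= !size_map.
rewrite spreadK /= zip_map -map_comp map_id_in // => -[m d] /wL /=.
by rewrite mem_letters /= => ?; congr pair; lia.
Qed.

(** Each m_j splits as d_j + (m_j - d_j), and position 0 collects the d_j; this gives |alpha| =
    |beta|. *)
Lemma sumn_profile w : all (fun l => l.2 <= l.1) w ->
  sumn (profile w) = sumn (unzip1 w).
Proof.
rewrite /profile /=; elim: w => //= -[m d] w IHw /= /andP[ledm /IHw <-]; lia.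
Qed.

Lemma word_triple_valid k b w : is_word k b k w -> valid b k (word_triple w).
Proof.
move=> /and3P[/allP wL /eqP sum1 sum2].
have wle : all (fun l => l.2 <= l.1) w.
  by apply/allP => l /wL /=; rewrite mem_letters => /andP[].
have w1 m : m \in unzip1 w -> 0 < m <= k.
  by case/mapP=> l /wL /=; rewrite mem_letters => /andP[lk _] ->.
split.
- rewrite /is_composition sumn_vals vals_gt0 sumn_profile // sum1 eqxx /= andbT.
  by apply/allP => m /w1 /andP[].
- apply/andP; split; apply/allP => m /=; last by case/w1/andP.
  (* Position 0 holds the sum of the d_j, at most [k] by [sum2]; the later ones hold m_j - d_j <=
     m_j <= k. *)
  case/mapP=> j + ->; rewrite mem_supp; case: j => [//|j] /=.
  have [ltj _|?] := ltnP j (size w); last by rewrite nth_default ?size_map.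
  rewrite (nth_map (0, 0)) //; have := wL _ (mem_nth (0, 0) ltj).
  by rewrite /= mem_letters; case: nth => /= m' d'; lia.
- exact: size_vals.
- rewrite sorted_supp; apply/allP => j; rewrite mem_filter mem_iota /= !size_map.
  by case/andP.
move=> i; rewrite size_vals => lti; rewrite (nth_map 0) //.
have := mem_nth 0 lti; rewrite mem_supp; case: (nth 0 _ i) => [//|j] /= + _.
have [ltj _|?] := ltnP j (size w); last by rewrite nth_default ?size_map.
by rewrite !(nth_map (0, 0)) // leq_subr.
Qed.

Section Drops.
Variables s t : seq nat.
Hypothesis le_st : all2 leq s t.
(** The word rebuilt from [t] = beta and [s] = (a_1, a_2, ...). *)
Let w := [seq (p.1, p.1 - p.2) | p <- zip t s].

Lemma unzip1_drops : unzip1 w = t.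
Proof.
by rewrite /w; elim: s t le_st => [|m s' IHs] [|m' t'] //= /andP[_ /IHs ->].
Qed.

Lemma subn_drops : [seq l.1 - l.2 | l <- w] = s.
Proof.
rewrite /w; elim: s t le_st => [|m s' IHs] [|m' t'] //= /andP[le /IHs ->].
by rewrite subKn.
Qed.

Lemma sumn_drops : sumn (unzip2 w) + sumn s = sumn t.
Proof.
rewrite /w; elim: s t le_st => [|m s' IHs] [|m' t'] //= /andP[le /IHs <-]; lia.
Qed.

End Drops.

Lemma triple_wordP b k t : valid b k t ->
  is_word k b k (triple_word t) /\ word_triple (triple_word t) = t.
Proof.
case: t => [[v beta] F] [/andP[/andP[v0 /eqP sv] /andP[b0 /eqP sb]]].
move=> /andP[vk bk] szv /andP[sF bF] le; rewrite /triple_word.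
have supp_A := supp_spread sF bF szv v0.
have vals_A := vals_spread sF bF szv v0.
set A := spread _ _ _ in supp_A vals_A *.
case DA: A => [//|a0 s] /=.
have szs : size s = size beta.
  by have /eqP := size_mkseq (fun j => nth 0 v (index j F)) (size beta).+1;
     rewrite -/(spread _ v F) -/A DA eqSS => /eqP.
have nthA j : j <= size beta -> nth 0 A j = nth 0 v (index j F).
  by move=> lej; rewrite nth_mkseq.
(* If j + 1 is a value of f, a card condition bounds the entry; otherwise the entry is 0. *)
have le_s : all2 leq s beta.
  rewrite all2E szs eqxx /=; apply/(all_nthP (0, 0)) => j.
  rewrite size_zip szs minnn => ltj; rewrite nth_zip //=.
  rewrite -[nth 0 s j]/(nth 0 (a0 :: s) j.+1).
  rewrite -DA nthA //.
  have [jF|jF] := boolP (j.+1 \in F).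
    have ltjF : index j.+1 F < size v by rewrite szv index_mem.
    by have := le _ ltjF; rewrite nth_index //; apply.
  by rewrite nth_default // szv leqNgt index_mem.
have a0k : a0 <= k.
  have -> : a0 = nth 0 A 0 by rewrite DA.
  rewrite nthA //; have [lti|?] := ltnP (index 0 F) (size v).
    exact: (all_nthP 0 vk).
  by rewrite nth_default.
have sumA : a0 + sumn s = b by rewrite -sv -vals_A sumn_vals DA.
set w := [seq _ | p <- _].
(* Both alpha and beta have size [b], so the total drop equals a_0. *)
have sumw : sumn (unzip2 w) = a0.
  by have := sumn_drops le_s; rewrite -/w sb -sumA; lia.
split; last first.
  by rewrite /word_triple /profile sumw subn_drops // unzip1_drops // -DA vals_A supp_A.
rewrite /is_word unzip1_drops // sb eqxx sumw a0k !andbT.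
apply/allP => l lw /=; rewrite mem_letters.
have : l.1 \in beta by rewrite -(unzip1_drops le_s) map_f.
move=> l1; have /= := allP b0 _ l1; have /= := allP bk _ l1.
by case/mapP: lw => -[m a] _ -> /=; lia.
Qed.

Lemma J_words b k : J b k = size (words k b b k).
Proof.
rewrite /J cardE -(size_map (@triple_of b)) -(size_map word_triple).
apply: perm_size; apply: uniq_perm.
- by rewrite map_inj_uniq ?enum_uniq //; apply: triple_of_inj.
- rewrite map_inj_in_uniq ?words_uniq // => w w'.
  by rewrite !mem_words => /word_tripleK {2}<- /word_tripleK {2}<- ->.
move=> t; apply/validP/mapP => [/triple_wordP[tw tE]|[w]].
  by exists (triple_word t); rewrite ?mem_words.
by rewrite mem_words => /word_triple_valid wv ->.
Qed.

(** * Generating functions of words *)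

Local Open Scope ring_scope.

Local Notation X := (fps_X int).

Lemma coefXM m (u : fps int) b :
  fps_coef (X ^+ m * u) b = if (m <= b)%N then fps_coef u (b - m) else 0.
Proof.
elim: m b => [|m IHm] b; first by rewrite mul1r subn0.
have coefX (v : fps int) i : fps_coef (X * v) i = if i is j.+1 then fps_coef v j else 0.
  rewrite fps_coefM big_ord_recl /= mul0r add0r.
  case: i => [|i]; first by rewrite big_ord0.
  rewrite big_ord_recl /= mul1r big1 ?addr0 ?subSS ?subn0 // => j _.
  by rewrite mul0r.
by rewrite exprS -mulrA coefX; case: b => [|b] //; rewrite IHm subSS.
Qed.

Definition words_fps k n : fps int := Fps (fun b => (size (words k b b n))%:Z).

(** The equation for G_n; the filter [d <= n] expresses G_i = 0 for i < 0, since [n - d] is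
    truncated. *)
Lemma words_fpsE k n : words_fps k n =
  1 + \sum_(1 <= m < k.+1)
        X ^+ m * \sum_(0 <= d < m.+1 | (d <= n)%N) words_fps k (n - d).
Proof.
apply: fpsP => b; rewrite fps_coefD fps_coef1 /= size_words PoszD natz.
congr (_ + _); rewrite big_mkcond /letters big_allpairs_dep /=.
have Posz_sum := big_morph Posz PoszD (erefl (Posz 0)).
rewrite Posz_sum fps_coef_sum /index_iota subSS subn0; apply: eq_bigr => m _.
rewrite coefXM Posz_sum; have [lemb|?] /= := leqP m b; last by rewrite big1.
by rewrite fps_coef_sum [RHS]big_mkcond; apply: eq_bigr => d _; case: ifP.
Qed.

(** * Sums over compositions by first part *)

Lemma comp_sum0 (V : nmodType) (F : seq nat -> V) :
  \sum_(a : composition 0) F a = F [::].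
Proof.
pose e : composition 0 := @Composition 0 [::] isT.
rewrite (bigD1 e) //= big1 ?addr0 // => a /negP[]; apply/eqP/val_inj/eqP.
by rewrite -size_eq0 -leqn0 comp_size.
Qed.

(** [F] acts on bare sequences because the summation types differ; both sides become sums over
    duplicate-free lists with the same members. *)
Lemma comp_sumS (V : nmodType) n (F : seq nat -> V) :
  \sum_(a : composition n.+1) F a =
  \sum_(0 <= m < n.+1) \sum_(a : composition (n - m)) F (m.+1 :: a).
Proof.
pose r m := [seq m.+1 :: val a | a <- enum {: composition (n - m)}].
transitivity (\sum_(s <- flatten [seq r m | m <- iota 0 n.+1]) F s).
  have -> : \sum_(a : composition n.+1) F a =
      \sum_(s <- [seq val a | a <- enum {: composition n.+1}]) F s.
    by rewrite big_map big_enum.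
  apply/perm_big/uniq_perm.
  - by rewrite map_inj_uniq ?enum_uniq //; apply: val_inj.
  - rewrite /r; apply: allpairs_uniq_dep => [|m _|]; rewrite ?iota_uniq ?enum_uniq //.
    move=> [m a] [m' a'] _ _ /= [Em]; subst m'.
    by move/val_inj => ->.
  move=> s; apply/mapP/flatten_mapP => [[a _ ->]|[m]].
    rewrite -[\val a]/(parts a).
    have [] := (comp_gt0 a, comp_sumn a); case: (parts a) => [|[|m] s'] //= s'0 Es.
    have sP : is_composition (n - m) s'.
      by rewrite /is_composition s'0 /=; apply/eqP; lia.
    exists m; first by rewrite -[_ \in _]/(m \in iota 0 n.+1) mem_iota; lia.
    by apply/mapP; exists (Composition sP); rewrite ?mem_enum.
  rewrite mem_iota => lemn /mapP[a _ ->].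
  have sP : is_composition n.+1 (m.+1 :: a).
    by rewrite /is_composition /= comp_gt0 comp_sumn /=; apply/eqP; lia.
  by exists (Composition sP); rewrite ?mem_enum.
rewrite big_flatten big_map /index_iota subn0; apply: eq_bigr => m _.
by rewrite big_map big_enum.
Qed.

(** * The recursion shared by both sides *)

Section Recursion.
Variable k : nat.
Let P : fps int := 1 - \sum_(1 <= m < k.+1) X ^+ m.
(** The sign of a first part m + 1, which counts in [ell2] exactly when m > 0. *)
Let eps m : fps int := if m == 0%N then 1 else -1.

Lemma words_fps0 : P * words_fps k 0 = 1.
Proof.
rewrite mulrBl mul1r mulr_suml {1}words_fpsE -addrA -[RHS]addr0; congr (_ + _).
apply/eqP; rewrite subr_eq0; apply/eqP; apply: eq_bigr => m _.
by rewrite big_mkcond big_nat_recl //= subn0 big1 ?addr0.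
Qed.

Lemma words_fpsS n : (n < k)%N -> P * words_fps k n.+1 =
  \sum_(0 <= m < n.+1) eps m * X ^+ m * words_fps k (n - m).
Proof.
move=> ltnk; pose G := words_fps k.
(* The inner sums telescope: for each m only G_(n+1) - G_(n-m) is left. *)
have GS : G n.+1 - G n = (\sum_(1 <= m < k.+1) X ^+ m) * G n.+1
    - \sum_(1 <= m < k.+1) X ^+ m * (if (m <= n)%N then G (n - m)%N else 0).
  rewrite /G {1}words_fpsE {1}[words_fps k n]words_fpsE.
  rewrite opprD addrACA subrr add0r mulr_suml -!sumrB.
  apply: eq_bigr => m _; rewrite -!mulrBr; congr (_ * _).
  rewrite big_mkcond big_nat_recl //= subn0.
  rewrite [Y in _ - Y]big_mkcond big_nat_recr //= addrKA.
  by congr (_ - _).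
have -> : P * words_fps k n.+1 = G n.+1 - G n
    - (\sum_(1 <= m < k.+1) X ^+ m) * G n.+1 + G n by rewrite /P /G; ring.
rewrite GS [_ - _ - _]addrAC subrr sub0r addrC.
rewrite [RHS]big_nat_recl //= !mul1r subn0; congr (_ + _).
(* As [n < k], the range covers all of 1, ..., n; the terms with m > n vanish. *)
rewrite (@big_cat_nat _ _ _ n.+1) //=; last exact: ltnW.
rewrite -[RHS]addr0 opprD; congr (_ + _); last first.
  rewrite big_nat big1 ?oppr0 // => m /andP[ltnm _].
  by rewrite leqNgt ltnm mulr0.
rewrite big_add1 /= -sumrN.
by apply: eq_big_nat => m /= ltmn; rewrite ltmn mulN1r mulNr.
Qed.

Lemma denom_unit : P \is a GRing.unit.
Proof. by apply/unitrPr; exists (words_fps k 0); exact: words_fps0. Qed.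

Definition weight n (s : seq nat) : fps int :=
  ((-1) ^+ ell2 s * X ^+ (n - size s)) / P ^+ (1 + size s).

(** The new part contributes its sign, x^m and one factor 1/P; the bound on [size s] makes the
    exponents add up despite truncated subtraction. *)
Lemma weight_cons n m s : (m <= n)%N -> (size s <= n - m)%N ->
  P * weight n.+1 (m.+1 :: s) = eps m * X ^+ m * weight (n - m) s.
Proof.
move=> lemn les; rewrite /weight /ell2 /= addnS exprS invrM ?unitrX ?denom_unit //.
rewrite mulrC -!mulrA mulVr ?denom_unit // mulr1.
rewrite subSS.
have -> : (n - size s = m + (n - m - size s))%N by lia.
rewrite !exprD /eps; case: m {lemn les} => [|m] /=; rewrite ?expr1; ring.
Qed.

(** Strong induction: after multiplication by the unit P, both sides obey the same recursion. *)
Lemma weight_sumE n : (n <= k)%N ->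
  \sum_(a : composition n) weight n a = words_fps k n.
Proof.
elim/ltn_ind: n => -[|n] IHn len; apply: (mulrI denom_unit).
  by rewrite words_fps0 comp_sum0 /weight expr1 !mul1r divrr ?denom_unit.
rewrite words_fpsS // comp_sumS mulr_sumr; apply: eq_big_nat => m /= ltmn.
rewrite -IHn; [|lia|lia]; rewrite !mulr_sumr; apply: eq_bigr => a _.
by rewrite weight_cons ?comp_size.
Qed.

End Recursion.

Theorem theorem3p5 (k : nat) (hk : (0 < k)%N) :
  Fps (fun b : nat => (J b k)%:Z) =
  \sum_(a : composition k)
    ((-1) ^+ ell2 a * fps_X int ^+ (k - size a)) /
    (1 - \sum_(1 <= i < k.+1) fps_X int ^+ i) ^+ (1 + size a).
Proof.
(* With n = k, the bound on the sum of the d_j is the capacity bound on a_0. *)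
transitivity (words_fps k k).
  by apply: fpsP => b /=; rewrite J_words.
by rewrite -(weight_sumE (leqnn k)).
Qed.
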